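(* Let $P_{2n+1}$ be the path on $2n+1\geq 5$ vertices with adjacency matrix $A$ and endpoints $u,v$, and let $Q=\mathrm{diag}(Q_1,\dots,Q_n,Q_{n+1},Q_n,\dots,Q_1)$ be any symmetric real potential. Then perfect state transfer from $u$ to $v$ for the Hamiltonian $H = A - Q$ cannot occur, for any values of $Q_1,\dots,Q_{n+1}$.
   Context: With $U(t) = e^{itH}$, perfect state transfer from $u$ to $v$ occurs at time $T$ if $|U(T)_{u,v}|=1$; the claim is that there is no such $T$. *)

(* Defs.v *)
From HB Require Import structures.
From mathcomp Require Import all_boot all_order all_algebra.
From mathcomp Require Import all_classical all_reals all_analysis.
From mathcomp Require Import complex.
Set Implicit Arguments. Unset Strict Implicit. Unset Printing Implicit Defensive.
Import Order.TTheory GRing.Theory Num.Theory.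
Import numFieldNormedType.Exports.
Local Open Scope ring_scope.
Local Open Scope complex_scope.
Local Open Scope classical_set_scope.

Definition expmx (R : realType) (m : nat) (M : 'M[R[i]]_m.+1) : 'M[R[i]]_m.+1 :=
  lim (series (fun k : nat => (k`!%:R : R[i])^-1 *: M ^+ k) @ \oo).

Definition path_adj (R : realType) (N : nat) : 'M[R]_N :=
  \matrix_(i, j) (if (i.+1 == j :> nat) || (j.+1 == i :> nat) then 1 else 0).

(* Symmetric potential on P_(2n+1): vertex i (0 <= i <= 2n) gets
   Q_(min(i, 2n - i) + 1); here q k plays the role of Q_(k+1). *)
Definition sym_potential (R : realType) (n : nat) (q : nat -> R) : 'M[R]_(n.*2.+1) :=
  diag_mx (\row_(i < n.*2.+1) q (minn i (n.*2 - i))).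

Definition hamiltonian (R : realType) (n : nat) (q : nat -> R) : 'M[R]_(n.*2.+1) :=
  path_adj R (n.*2.+1) - sym_potential n q.

Definition U_t (R : realType) (n : nat) (q : nat -> R) (t : R) : 'M[R[i]]_(n.*2.+1) :=
  expmx (('i * t%:C) *: map_mx (fun x : R => x%:C) (hamiltonian n q)).

Definition pst (R : realType) (n : nat) (q : nat -> R) (u v : 'I_(n.*2.+1)) (T : R) : Prop :=
  `|U_t n q T u v| = 1.

(* Main.v *)
(* Let d be the diagonal of H = A - Q, and let P_j, the characteristic polynomial
   of its leading j x j block, be given by P_(j+1) = (X - d_j) P_j - P_(j-1).
   Mirror symmetry splits the spectrum of H into the n roots of g = P_n
   (antisymmetric eigenvectors) and the n+1 roots of f = (X - d_n) P_n - 2 P_(n-1)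
   (symmetric eigenvectors).  |U(T)_(u,v)| = 1 is equality in a convex combination
   of unit complex numbers; it forces exp(i T l) to take one value on the roots of
   f and the opposite value on those of g.  After an affine change of variable with
   slope pi / T the roots of f are even integers and those of g odd integers, while
   the recurrence becomes P_(j+1) = (X - d_j) P_j - b P_(j-1) with b = (T / pi)^2.

   This is impossible 2-adically.  Comparing coefficients, d_n and 2b are
   integers, and running the recurrence downwards shows that every d_j is
   rational.  If the d_j (j < n) had common denominator 2^s N with N odd and
   s > 0, then rescaling by it and evaluating g at 1 modulo 2 would show that all
   rescaled d_j are even; so s = 0.  If b is an integer, then
   f = (X - d_n) g (mod 2) after rescaling by N, and the values at 1 disagree.  If
   2b is odd, then P_(n-1) = ((X - d_n) g - f) / 2b is 2-adically integral, hence so is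
   b P_(n-2) = (X - d_(n-1)) P_(n-1) - g, which has leading coefficient b. *)

Require Import Defs.
From HB Require Import structures.
From mathcomp Require Import all_boot all_order all_algebra.
From mathcomp Require Import all_classical all_reals all_analysis.
From mathcomp Require Import complex.
From mathcomp Require Import ring lra zify.
Set Implicit Arguments. Unset Strict Implicit. Unset Printing Implicit Defensive.
Import Order.TTheory GRing.Theory Num.Theory.
Import numFieldNormedType.Exports.
Local Open Scope ring_scope.
Local Open Scope complex_scope.

Local Notation "z ^*" := (Num.conj z).

(* Characteristic polynomial of the j x j Jacobi matrix with diagonal
   d 0, ..., d (j - 1) and constant product b of symmetric off-diagonal entries. *)
Fixpoint jac (A : comNzRingType) (d : nat -> A) (b : A) (j : nat) : {poly A} :=
  if j is i.+1 then
    ('X - (d i)%:P) * jac d b i - (if i is h.+1 then b *: jac d b h else 0)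
  else 1.

Arguments jac : simpl never.

(** * Jacobi polynomials *)

Section Jac.
Variable A : comNzRingType.
Implicit Types (d : nat -> A) (b : A).

Lemma jacSS d b j :
  jac d b j.+2 = ('X - (d j.+1)%:P) * jac d b j.+1 - b *: jac d b j.
Proof. by []. Qed.

Lemma jac0 d b : jac d b 0 = 1.
Proof. by []. Qed.

Lemma jac1 d b : jac d b 1 = 'X - (d 0)%:P.
Proof. by rewrite /jac mulr1 subr0. Qed.

Lemma jac_ind (P : nat -> Prop) :
  P 0 -> P 1 -> (forall j, P j -> P j.+1 -> P j.+2) -> forall j, P j.
Proof.
move=> P0 P1 PS j; suff [] : P j /\ P j.+1 by [].
by elim: j => [|j [? ?]]; split; auto.
Qed.

Lemma eq_jac d d' b j : (forall i, (i < j)%N -> d i = d' i) ->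
  jac d b j = jac d' b j.
Proof.
elim/jac_ind: j => [//|/(_ 0) dd'|j IH1 IH2 dd'].
  by rewrite !jac1 dd'.
rewrite !jacSS IH1 => [|i /leqW/leqW/dd' //].
by rewrite IH2 ?dd' // => i /leqW/dd'.
Qed.

(** Both facts go through one induction: the size of [jac d b j] shows that the subtracted term
    cannot reach the leading term. *)
Lemma jac_monic_size d b j : jac d b j \is monic /\ size (jac d b j) = j.+1.
Proof.
elim/jac_ind: j => [||j [m1 s1] [m2 s2]].
- by rewrite jac0 monic1 size_poly1.
- by rewrite jac1 monicXsubC size_XsubC.
rewrite jacSS; set p := (_ * jac d b j.+1).
have mp : p \is monic by rewrite rpredM ?monicXsubC.
have sp : size p = j.+3.
  by rewrite size_Mmonic ?s2 ?size_XsubC // -size_poly_gt0 size_XsubC.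
have lt : (size (- (b *: jac d b j)) < size p)%N.
  by rewrite sp size_polyN (leq_ltn_trans (size_scale_leq _ _)) // s1.
by rewrite monicE lead_coefDl // size_polyDl.
Qed.

Lemma jac_monic d b j : jac d b j \is monic.
Proof. by case: (jac_monic_size d b j). Qed.

Lemma size_jac d b j : size (jac d b j) = j.+1.
Proof. by case: (jac_monic_size d b j). Qed.

Lemma jac_coef d b j : (jac d b j)`_j = 1.
Proof. by have /monicP := jac_monic d b j; rewrite /lead_coef size_jac. Qed.

(** Two consecutive polynomials thus determine a diagonal entry; rationality of the entries is read
    off this way. *)
Lemma jac_coef_subdiag d b j :
  (jac d b j.+2)`_j.+1 = (jac d b j.+1)`_j - d j.+1.
Proof.
rewrite jacSS mulrBl mul_polyC coefB coefB coefXM /= !coefZ jac_coef mulr1.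
by rewrite [(jac _ _ j)`_ _]nth_default ?size_jac // mulr0 subr0.
Qed.

(** Replacing a Jacobi matrix J by a J + c multiplies the off-diagonal products by the square of a,
    and the determinant of x - J by [a ^+ j]. *)
Lemma horner_jac_affine a c d b x j :
  (jac (fun i => a * d i + c) (a ^+ 2 * b) j).[a * x + c] =
  a ^+ j * (jac d b j).[x].
Proof.
elim/jac_ind: j => [||j IH1 IH2]; first by rewrite !jac0 !hornerE.
- by rewrite !jac1 !hornerE; ring.
rewrite !jacSS hornerD hornerN hornerM hornerZ IH1 IH2.
rewrite [in RHS]hornerD hornerN hornerM hornerZ !hornerXsubC !exprS; ring.
Qed.

Lemma jac_b0 d j : jac d 0 j = \prod_(i < j) ('X - (d i)%:P).
Proof.
elim/jac_ind: j => [||j IH1 IH2]; first by rewrite big_ord0.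
  by rewrite jac1 big_ord_recl big_ord0 mulr1.
by rewrite jacSS scale0r subr0 IH2 mulrC [in RHS]big_ord_recr.
Qed.

End Jac.

Lemma map_jac (A B : comNzRingType) (f : {rmorphism A -> B}) d b j :
  map_poly f (jac d b j) = jac (f \o d) (f b) j.
Proof.
elim/jac_ind: j => [||j IH1 IH2]; first by rewrite !jac0 rmorph1.
  by rewrite !jac1 rmorphB /= map_polyX map_polyC.
by rewrite !jacSS rmorphB rmorphM rmorphB /= map_polyX map_polyC map_polyZ IH1 IH2.
Qed.

(* Characteristic polynomial of the mirror-symmetric Jacobi matrix of size 2n + 1
   restricted to symmetric vectors; [jac d b n] is the antisymmetric counterpart. *)
Definition sym_jac (K : comNzRingType) (d : nat -> K) b n : {poly K} :=
  ('X - (d n)%:P) * jac d b n - (2 * b) *: jac d b n.-1.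

Lemma sym_jac_monic_size (K : comNzRingType) (d : nat -> K) b n :
  sym_jac d b n.+1 \is monic /\ size (sym_jac d b n.+1) = n.+3.
Proof.
rewrite /sym_jac; set p := (_ * jac d b n.+1).
have mp : p \is monic by rewrite rpredM ?monicXsubC ?jac_monic.
have sp : size p = n.+3.
  by rewrite size_Mmonic ?jac_monic ?size_jac ?size_XsubC // -size_poly_gt0 size_XsubC.
have lt : (size (- ((2 * b) *: jac d b n)) < size p)%N.
  by rewrite sp size_polyN (leq_ltn_trans (size_scale_leq _ _)) // size_jac.
by rewrite monicE lead_coefDl // size_polyDl.
Qed.

(** The index starts at 1: at 0 the truncated [0.-1] would make the last term scale by [a ^+ 2]
    while the first scales by [a]. *)
Lemma horner_sym_jac_affine (K : comNzRingType) (a c : K) d b x n :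
  (sym_jac (fun i => a * d i + c) (a ^+ 2 * b) n.+1).[a * x + c] =
  a ^+ n.+2 * (sym_jac d b n.+1).[x].
Proof.
rewrite /sym_jac !(hornerD, hornerN) ![(_ * jac _ _ _).[_]]hornerM !hornerXsubC !hornerZ.
by rewrite !horner_jac_affine !exprS; ring.
Qed.

Lemma map_sym_jac (A B : comNzRingType) (f : {rmorphism A -> B}) d b n :
  map_poly f (sym_jac d b n) = sym_jac (f \o d) (f b) n.
Proof.
rewrite /sym_jac rmorphB rmorphM rmorphB /= map_polyX map_polyC map_polyZ !map_jac.
by rewrite rmorphM rmorph_nat.
Qed.

Lemma eq_sym_jac (A : comNzRingType) (d d' : nat -> A) b n :
  d =1 d' -> sym_jac d b n = sym_jac d' b n.
Proof. by move=> dd'; rewrite /sym_jac dd'; congr (_ * _ - _ *: _); apply: eq_jac. Qed.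

(** Clears denominators, so that values of rational Jacobi polynomials can be reduced modulo 2. *)
Lemma horner_jac_int (e : nat -> rat) (b a : rat) (z : nat -> int) (B : int) j y :
  a != 0 -> (forall i, (i < j)%N -> a * e i = (z i)%:~R) -> a ^+ 2 * b = B%:~R ->
  (jac z B j).[y]%:~R = a ^+ j * (jac e b j).[y%:~R / a].
Proof.
move=> a0 zE BE; rewrite -(horner_jac_affine a 0).
rewrite -horner_map map_jac BE addr0 mulrCA divff // mulr1.
by congr (_.[_]); apply: eq_jac => i ij; rewrite /= addr0 zE.
Qed.

Lemma prod_scale (A : comNzRingType) (I : Type) (s : seq I) (f : I -> A) a x :
  a ^+ size s * (\prod_(i <- s) ('X - (f i)%:P)).[x] = \prod_(i <- s) (a * x - a * f i).
Proof.
elim: s => [|i s IH]; first by rewrite !big_nil hornerC mulr1.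
by rewrite !big_cons hornerM hornerXsubC -IH /= exprS; ring.
Qed.

(** * The 2-adic obstruction *)

Lemma natr_F2 (k : nat) : k%:R = (odd k)%:R :> 'F_2.
Proof. by rewrite -[in LHS](odd_double_half k) natrD -mul2n natrM pchar_Zp // mul0r addr0. Qed.

Lemma intr_F2_eq0 (z : int) : z%:~R = 0 :> 'F_2 -> exists w, z = 2 * w.
Proof.
move=> z0; exists (z %/ 2)%Z.
suff: ~~ odd `|z|%N by lia.
have {z0} : `|z|%:R = 0 :> 'F_2.
  by case: (intP z) z0 => // m; rewrite rmorphN => /eqP; rewrite oppr_eq0 => /eqP.
by rewrite natr_F2; case: (odd _) => // /(congr1 val).
Qed.

Lemma intr_F2_double (w : int) : (2 * w)%:~R = 0 :> 'F_2.
Proof. by rewrite rmorphM rmorph_nat (_ : 2%:R = 0 :> 'F_2) ?mul0r //; apply/val_inj. Qed.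

Lemma F2_case (x : 'F_2) : x = 0 \/ x = 1.
Proof. by case: x => [[|[|//]] ?]; [left|right]; apply/val_inj. Qed.

(** The 2-adic contradiction for rational entries, with half length [n.+2] and [m] equal to 2b. The
    polynomial [r] records that 2b times the polynomial just below the antisymmetric one is
    integral, which settles the case of odd [m]. *)
Lemma rat_parity_spectrum_absurd (n : nat) (e : nat -> rat) (b : rat) (ls ms : seq int) 
    (k m : int) (r : {poly int}) :
  size ls = n.+3 -> size ms = n.+2 ->
  jac e b n.+2 = \prod_(o <- ms) ('X - (2 * o + 1)%:~R%:P) ->
  sym_jac e b n.+2 = \prod_(a <- ls) ('X - (2 * a)%:~R%:P) ->
  e n.+2 = k%:~R -> 2 * b = m%:~R ->
  m%:~R *: jac e b n.+1 = map_poly intr r ->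
  False.
Proof.
rewrite /sym_jac => sls sms gE fE kE mE rE.
(* The entry [e n.+2] is left out of the common denominator, being the integer [k]. *)
pose D := (\prod_(j < n.+2) `|denq (e j)|)%N.
have D0 : (0 < D)%N by apply/prodn_gt0 => j; rewrite absz_gt0 denq_eq0.
have De j : (j < n.+2)%N -> D%:R * e j \is a Num.int.
  move=> jn; rewrite /D (bigD1 (Ordinal jn)) //= natrM mulrAC rpredM ?rpred_nat //.
  rewrite -{2}[e j]divq_num_den natr_absz gtr0_norm ?denq_gt0 // mulrC divfK ?intr_eq0 ?denq_neq0 //.
  by rewrite rpred_int.
have [N oN DE] : exists2 N, odd N & D = (N * 2 ^ logn 2 D)%N.
  by have [N oN DE] := pfactor_coprime (isT : prime 2) D0; exists N; rewrite // -coprime2n.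
move: (logn 2 D) DE => s DE.
(* The case of a denominator 2^(t+1) N: rescale by it and evaluate at 1 modulo 2. *)
have step t : (forall j, (j < n.+2)%N -> (N * 2 ^ t.+1)%:R * e j \is a Num.int) ->
    forall j, (j < n.+2)%N -> (N * 2 ^ t)%:R * e j \is a Num.int.
  move=> H.
  set E := (N * 2 ^ t.+1)%N in H.
  pose z j := Num.floor (E%:R * e j).
  have zE j : (j < n.+2)%N -> E%:R * e j = (z j)%:~R.
    by move=> jn; rewrite /z floorK // H.
  (* One factor 2 of [E ^+ 2] turns b into the integer [m], and another is left over: [B] is even
     even if b is only half an integer. *)
  pose B : int := 2 * (N%:R ^+ 2 * 4 ^+ t * m).
  have BE : E%:R ^+ 2 * b = B%:~R.
    rewrite /B !rmorphM /= !rmorphXn /= !rmorph_nat -mE /E ?natrM ?natrX exprS.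
    have -> : 4 ^+ t = (2 ^+ t) ^+ 2 :> rat by rewrite exprAC; congr (_ ^+ _); ring.
    rewrite expr1 exprS; ring.
  have E0 : E%:R != 0 :> rat by rewrite pnatr_eq0 -lt0n muln_gt0 expn_gt0 odd_gt0.
  have ev : (jac z B n.+2).[1] = \prod_(o <- ms) (1 - E%:R * (2 * o + 1)).
    apply/(@intr_inj rat).
    rewrite (horner_jac_int _ E0 zE BE) gE -sms prod_scale rmorph_prod.
    by apply: eq_bigr => o _; rewrite mulrCA divff // mulr1 /= intrB intrM mulrz_nat.
  have := congr1 (intr : int -> 'F_2) ev.
  (* Modulo 2 the off-diagonal term disappears and the left side is the product of the [1 - z j].
     Since [E] is even the right side is 1, so no [z j] is odd. *)
  rewrite -[LHS]horner_map map_jac /= /B intr_F2_double jac_b0 horner_prod rmorph_prod.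
  rewrite [X in _ = X -> _]big1 => [|o _]; last first.
    by rewrite /= /E expnS mulnCA natrM -mulrA intrB intr_F2_double subr0.
  move=> pz j jn.
  have /intr_F2_eq0[w zw] : (z j)%:~R = 0 :> 'F_2.
    have [//|z1] := F2_case (z j)%:~R.
    move: pz; rewrite (bigD1 (Ordinal jn)) //= rmorph1 hornerXsubC z1 subrr mul0r => /eqP.
    by rewrite eq_sym oner_eq0.
  have -> : (N * 2 ^ t)%:R * e j = w%:~R; last by rewrite rpred_int.
  apply: (@mulfI _ 2) => //.
  by rewrite mulrA -natrM mulnCA -expnS zE // zw rmorphM.
have {step De} Nz j : (j < n.+2)%N -> N%:R * e j \is a Num.int.
  have -> : N = (N * 2 ^ 0)%N by rewrite muln1.
  move: j; rewrite DE in De; elim: s De {DE} => // s IH /step; exact: IH.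
pose z j := Num.floor (N%:R * e j).
have zE j : (j < n.+3)%N -> N%:R * e j = (z j)%:~R.
  rewrite ltnS leq_eqVlt /z => jn; rewrite floorK //; case/orP: jn => [/eqP -> |/Nz //].
  by rewrite kE rpredM ?rpred_nat ?rpred_int.
have N0 : N%:R != 0 :> rat by rewrite pnatr_eq0 -lt0n odd_gt0.
have N1 : N%:R = 1 :> 'F_2 by rewrite natr_F2 oN.
(* Integral b: evaluate at 1 modulo 2. Half-integral b: coefficient of degree n. *)
have [/intr_F2_eq0[w mw]|m1] := F2_case m%:~R.
  have bw : b = w%:~R by apply: (@mulfI _ 2) => //; rewrite mE mw intrM.
  have [B BE] : exists B : int, N%:R ^+ 2 * b = B%:~R.
    by exists (N%:R ^+ 2 * w); rewrite bw intrM rmorphXn /= mulrz_nat.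
  have gev : (jac z B n.+2).[1] = \prod_(o <- ms) (1 - N%:R * (2 * o + 1)).
    apply/(@intr_inj rat).
    rewrite (horner_jac_int _ N0 (fun j jn => zE j (leqW jn)) BE) gE -sms prod_scale rmorph_prod.
    by apply: eq_bigr => o _; rewrite mulrCA divff // mulr1 /= intrB intrM mulrz_nat.
  have ev : (1 - z n.+2) * (jac z B n.+2).[1] - 2 * B * (jac z B n.+1).[1] =
      \prod_(a <- ls) (1 - 2 * (N%:R * a)).
    apply/(@intr_inj rat).
    rewrite intrB !intrM.
    rewrite (horner_jac_int _ N0 (fun j jn => zE j (leqW jn)) BE).
    rewrite (horner_jac_int _ N0 (fun j jn => zE j (leqW (leqW jn))) BE).
    have := congr1 (fun p => N%:R ^+ n.+3 * p.[1 / N%:R]) fE.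
    rewrite -sls prod_scale sls rmorph_prod /=.
    rewrite hornerD hornerN hornerM hornerZ hornerXsubC => E.
    transitivity (\prod_(i <- ls) (N%:R * (1 / N%:R) - N%:R * (2 * i)%:~R) : rat); last first.
      by apply: eq_bigr => i _; rewrite mulrCA divff // intrB !intrM mulrz_nat; ring.
    rewrite -E intrB -(zE _ (ltnSn _)) -BE !exprS.
    by field.
  (* Modulo 2 the right side is 1. On the left only a multiple of the value in [gev] survives, and
     it has an even factor [1 - N * (2 * o + 1)] because [ms] is nonempty. *)
  have := congr1 (intr : int -> 'F_2) ev.
  rewrite gev intrB intrM intr_F2_double mul0r subr0 intrM.
  case: (ms) sms => // o ms' _; rewrite big_cons [X in _ * X]intrM.
  rewrite [(1 - N%:R * _)%:~R]intrB intrM [(2 * o + 1)%:~R]intrD intr_F2_double add0r mulrz_nat N1 mulr1 subrr.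
  rewrite mul0r mulr0.
  rewrite rmorph_prod big1 => [/eqP|a _]; first by rewrite eq_sym oner_eq0.
  by rewrite /= intrB intr_F2_double subr0.
pose G := (\prod_(o <- ms) ('X - (2 * o + 1)%:P) : {poly int})`_n.
(* The multiplier makes all terms integral: [m] turns [jac e b n.+1] into [r], [N] clears [e n.+1],
   and 2 clears b. As [jac e b n] is monic of degree n, its term contributes [N * m * m], which is
   odd, while all others are even. *)
have := congr1 (fun p : {poly rat} => 2 * N%:R * m%:~R * p`_n) (jacSS e b n).
rewrite gE (_ : \prod_(_ <- _) _ = map_poly intr (\prod_(o <- ms) ('X - (2 * o + 1)%:P))); last first.
  by rewrite rmorph_prod; apply: eq_bigr => o _; rewrite rmorphB /= map_polyX map_polyC.
rewrite coef_map /= -/G => E.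
have : 2 * (N%:R * m * G - N%:R * ('X * r)`_n + z n.+1 * r`_n) = - (N%:R * m * m).
  apply/(@intr_inj rat).
  have rn : (r`_n)%:~R = m%:~R * (jac e b n.+1)`_n by rewrite -(coef_map intr) -rE coefZ.
  have Xrn : (('X * r)`_n)%:~R = m%:~R * ('X * jac e b n.+1)`_n.
    by rewrite -(coef_map intr) rmorphM /= map_polyX -rE -scalerAr coefZ.
  move: E; rewrite mulrBl mul_polyC !coefB !coefZ jac_coef => E.
  rewrite !(intrN, intrD, intrM) mulrz_nat -(zE n.+1) // rn Xrn.
  transitivity (2 * N%:R * m%:~R * G%:~R - 2 * N%:R * m%:~R * (('X * jac e b n.+1)`_n - e n.+1 * (jac e b n.+1)`_n)).
    ring.
  by transitivity (- (N%:R * m%:~R * (2 * b))); [rewrite E; ring | rewrite mE].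
move/(congr1 (intr : int -> 'F_2)); rewrite intr_F2_double intrN !intrM mulrz_nat N1 m1 => /eqP.
by rewrite eq_sym oppr_eq0 !mul1r oner_eq0.
Qed.

(** Reduces to rational entries: the integral factorizations make the two top polynomials rational,
    and dividing by the nonzero [b] carries this down the recurrence. *)
Lemma parity_spectrum_absurd (F : numFieldType) (n : nat) (d : nat -> F) (b : F) (ls ms : seq int) :
  b != 0 -> size ls = n.+3 -> size ms = n.+2 ->
  jac d b n.+2 = \prod_(o <- ms) ('X - (2 * o + 1)%:~R%:P) ->
  sym_jac d b n.+2 = \prod_(a <- ls) ('X - (2 * a)%:~R%:P) ->
  False.
Proof.
rewrite /sym_jac => b0 sls sms gE fE.
pose P (c : int -> int) s : {poly int} := \prod_(x <- s) ('X - (c x)%:P).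
have PE (K : numFieldType) c s : \prod_(x <- s) ('X - (c x)%:~R%:P) = map_poly intr (P c s) :> {poly K}.
  by rewrite rmorph_prod; apply: eq_bigr => o _; rewrite rmorphB /= map_polyX map_polyC.
pose g := P (fun o => 2 * o + 1) ms; pose f := P (fun a => 2 * a) ls.
rewrite PE -/g in gE; rewrite PE -/f in fE.
have [k kE] : exists k : int, d n.+2 = k%:~R.
  (* Degree [n.+2] is above that of [jac d b n.+1], so [f] and [('X - d n.+2) * g] have the same
     coefficient there. *)
  exists (g`_n.+1 - f`_n.+2).
  have := congr1 (fun p : {poly F} => p`_n.+2) fE.
  rewrite mulrBl mul_polyC !coefB !coefZ coefXM jac_coef [(jac _ _ n.+1)`_ _]nth_default ?size_jac //=.
  by rewrite gE !coef_map /= mulr0 subr0 mulr1 intrB => <-; rewrite subKr.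
(* Integral form of [(2 * b) *: jac d b n.+1]; its leading coefficient shows that 2b is an
   integer. *)
pose r := ('X - k%:P) * g - f.
have rE : (2 * b) *: jac d b n.+1 = map_poly intr r.
  by rewrite rmorphB rmorphM rmorphB /= map_polyX map_polyC /= -gE -fE -kE subKr.
have mE : 2 * b = (r`_n.+1)%:~R.
  by rewrite -(coef_map intr) -rE coefZ jac_coef mulr1.
set m := r`_n.+1 in mE.
pose bq : rat := m%:~R / 2.
have mq : m%:~R = 2 * bq by rewrite mulrCA divff ?mulr1.
have bE : b = ratr bq.
  apply: (@mulfI _ 2); first by rewrite pnatr_eq0.
  by rewrite mE -[LHS](ratr_int F) mq rmorphM /= rmorph_nat.
have bq0 : bq != 0 by move: b0; rewrite bE fmorph_eq0.
pose rat_poly (p : {poly F}) := exists q, p = map_poly ratr q.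
have dE j : rat_poly (jac d b j) -> rat_poly (jac d b j.+1) -> exists q, d j = ratr q.
  case: j => [|j] [p pE] [q qE].
    exists (- q`_0); rewrite rmorphN -(coef_map ratr) -qE jac1.
    by rewrite coefB coefX coefC sub0r opprK.
  by exists (p`_j - q`_j.+1); rewrite rmorphB -!(coef_map ratr) -pE -qE jac_coef_subdiag subKr.
have intr_ratr (p : {poly int}) : map_poly intr p = map_poly ratr (map_poly intr p) :> {poly F}.
  by rewrite -map_poly_comp; apply: eq_map_poly => x /=; rewrite ratr_int.
(* Rationality propagates down the recurrence from j = n + 1. *)
have ratp i : forall j, (j + i = n.+1)%N -> rat_poly (jac d b j) /\ rat_poly (jac d b j.+1).
  elim: i => [|i IH] j jn.
    rewrite addn0 in jn; rewrite jn; split; last by exists (map_poly intr g); rewrite gE intr_ratr.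
    exists ((2 * bq)^-1 *: map_poly intr r); rewrite map_polyZ -intr_ratr -rE scalerA.
    by rewrite fmorphV rmorphM /= rmorph_nat -bE mulVf ?scale1r // mulf_neq0 // pnatr_eq0.
  have [|H1 H2] := IH j.+1; first by rewrite addSnnS.
  split=> //; have [c cE] := dE _ H1 H2; case: H1 H2 => [p pE] [q qE].
  exists (bq^-1 *: (('X - c%:P) * p - q)).
  rewrite map_polyZ rmorphB rmorphM rmorphB /= map_polyX map_polyC /= -pE -qE -cE (jacSS d b j) subKr.
  by rewrite scalerA fmorphV /= -bE mulVf // scale1r.
have [e eE] : exists e : nat -> rat, forall j, (j < n.+3)%N -> d j = ratr (e j).
  suff /choice[e eE] : forall j, exists q, (j < n.+3)%N -> d j = ratr q by exists e.
  move=> j.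
  (* The value 0 is a placeholder: neither polynomial involves entries from index [n.+3] on. *)
  have [jn|jn] := ltnP j n.+3; last by exists 0.
  move: jn; rewrite ltnS leq_eqVlt => /orP[/eqP ->|jn].
    by exists k%:~R => _; rewrite ratr_int.
  have [|H1 H2] := ratp (n.+1 - j)%N j; first by rewrite subnKC.
  by have [q qE] := dE j H1 H2; exists q.
have jE j : (j < n.+3)%N -> jac d b j = map_poly ratr (jac e bq j).
  by move=> jn; rewrite map_jac /= -bE; apply: eq_jac => i ij; rewrite eE // (ltn_trans ij).
have inj := map_poly_inj (ratr : {rmorphism rat -> F}).
apply: (@rat_parity_spectrum_absurd n e bq ls ms k m r) => //.
- by apply: inj; rewrite -jE // PE -intr_ratr.
- apply: inj; rewrite PE -/f -intr_ratr -fE rmorphB /= map_polyZ rmorphM /= rmorphB /= map_polyX map_polyC /=.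
  by rewrite -!jE // -eE // rmorphM /= rmorph_nat -bE.
- by apply: (fmorph_inj (ratr : {rmorphism rat -> F})); rewrite /= -eE // ratr_int.
- by apply: inj; rewrite -intr_ratr -rE map_polyZ -jE //= ratr_int mE.
Qed.

(** * Eigenvectors of a mirror-symmetric path *)

(** [N] is the last vertex, not the number of vertices. Vectors are sequences on [nat], so that the
    recurrence can be run without ordinals. *)
Definition path_nbr_sum (K : nmodType) N (x : nat -> K) j : K :=
  (if j is i.+1 then x i else 0) + (if (j < N)%N then x j.+1 else 0).

Lemma sum_path_adj (K : pzRingType) N (x : nat -> K) (j : 'I_N.+1) :
  \sum_(i < N.+1) x i * (if (i.+1 == j) || (j.+1 == i :> nat) then 1 else 0) =
  path_nbr_sum N x j.
Proof.
transitivity (\sum_(i < N.+1 | i.+1 == j) x i + \sum_(i < N.+1 | j.+1 == i :> nat) x i).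
  rewrite [X in _ = X + _]big_mkcond [X in _ = _ + X]big_mkcond -big_split /=.
  apply: eq_bigr => i _; case: eqP => [ij|_] /=.
    by rewrite mulr1 -ij eqn_leq ltnNge leqnSn /= ?addr0 // ltnS leqW ?addr0.
  by case: eqP; rewrite ?mulr1 ?mulr0 add0r.
congr (_ + _).
  case: j => -[|j] jN /=; first by rewrite big_pred0.
  by rewrite (big_pred1 (Ordinal (ltnW jN))) // => i; rewrite eqSS.
case: ltnP => jN; last by rewrite big_pred0 // => i; apply/eqP; have := ltn_ord i; lia.
by rewrite (big_pred1 (Ordinal (jN : (j.+1 < N.+1)%N))) // => i; rewrite eq_sym.
Qed.

(** Row j of the eigenvalue equation gives [x j.+1] from the two previous entries, by the recurrence
    of [jac] with [b = 1]. *)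
Lemma jac_eigenvector (K : comNzRingType) N (d x : nat -> K) l :
  (forall j, (j < N)%N -> path_nbr_sum N x j + d j * x j = l * x j) ->
  forall j, (j <= N)%N -> x j = (jac d 1 j).[l] * x 0.
Proof.
move=> E; elim/jac_ind => [||j IH1 IH2] jN.
- by rewrite jac0 hornerC mul1r.
- have := E 0 jN; rewrite /path_nbr_sum jN add0r jac1 hornerXsubC => e.
  by rewrite mulrBl -e addrK.
- have := E _ jN; rewrite /path_nbr_sum jN (IH1 (ltnW (ltnW jN))) (IH2 (ltnW jN)) => e.
  rewrite jacSS hornerD hornerN hornerM hornerZ hornerXsubC mul1r.
  by rewrite mulrBl -mulrA mulrBl -e; ring.
Qed.

(** A common root of two consecutive polynomials would descend, dividing by [b], to the constant
    [jac d b 0 = 1]. *)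
Lemma jac_no_common_root (K : idomainType) (d : nat -> K) b l j :
  b != 0 -> root (jac d b j.+1) l -> ~~ root (jac d b j) l.
Proof.
move=> b0; elim: j => [|j IH] r2; first by rewrite jac0 root1.
apply/negP => r1; have /negP := IH r1; apply.
move: r2; rewrite /root jacSS hornerD hornerN hornerM hornerZ (eqP r1) mulr0 sub0r.
by rewrite oppr_eq0 mulf_eq0 (negbTE b0).
Qed.

(** The reflected vector obeys the same recurrence, so both are multiples of one sequence and agree
    at the centre. If that sequence does not vanish there, the end entries are equal; if it does,
    the central row makes them opposite. *)
Lemma mirror_eigenvector (K : fieldType) n (d x : nat -> K) l :
  (0 < n)%N -> x 0 != 0 ->
  (forall j, (j <= n.*2)%N -> d (n.*2 - j)%N = d j) ->
  (forall j, (j <= n.*2)%N -> path_nbr_sum n.*2 x j + d j * x j = l * x j) ->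
  (x n.*2 = x 0 /\ root (sym_jac d 1 n) l) \/
  (x n.*2 = - x 0 /\ root (jac d 1 n) l).
Proof.
case: n => // n _ x0 dsym E; set N := n.+1.*2 in dsym E *.
have xE j : (j <= N)%N -> x j = (jac d 1 j).[l] * x 0.
  by apply: jac_eigenvector => i /ltnW; apply: E.
pose y j := x (N - j)%N.
have yE j : (j <= N)%N -> y j = (jac d 1 j).[l] * y 0.
  apply: jac_eigenvector => i iN; rewrite -(dsym _ (ltnW iN)).
  have := E (N - i)%N (leq_subr _ _); rewrite -/(y i) => <-; congr (_ + _).
  rewrite /path_nbr_sum iN [RHS]addrC; congr (_ + _); last by rewrite -(subnSK iN).
  case: i iN => [|i] iN; first by rewrite subn0 ltnn.
  by rewrite ltn_subrL /= subnSK // ltnW.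
have NN : N = (n.+1 + n.+1)%N by rewrite addnn.
have nN : (n.+1 <= N)%N by rewrite NN leq_addr.
have mid : (jac d 1 n.+1).[l] * x 0 = (jac d 1 n.+1).[l] * x N.
  by rewrite -[x N]/(x (N - 0)%N) -/(y 0) -xE // -yE // /y NN addnK.
(* The central row: its left neighbour is reached from the end 0, its right neighbour from the end
   [N] through the reflection. *)
have row : (jac d 1 n).[l] * (x 0 + x N) = (l - d n.+1) * ((jac d 1 n.+1).[l] * x 0).
  have := E _ nN; rewrite /path_nbr_sum (_ : (n.+1 < N)%N); last by rewrite NN addSnnS leq_addl.
  rewrite (xE _ nN) => e; rewrite mulrBl -e addrK mulrDr -xE; last exact: ltnW.
  by rewrite -[x N]/(x (N - 0)%N) -/(y 0) -yE ?(ltnW nN) // /y NN; congr (_ + x _); lia.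
have [g0|g0] := eqVneq (jac d 1 n.+1).[l] 0; [right|left].
  split; last exact/eqP.
  have /negbTE p0 : ~~ root (jac d 1 n) l by apply: jac_no_common_root; rewrite ?oner_eq0 //; apply/eqP.
  move/eqP: row; rewrite g0 mul0r mulr0 mulf_eq0 -[_ == 0]/(root _ _) p0 /=.
  by rewrite addrC addr_eq0 => /eqP.
have x0N := mulfI g0 mid; split=> //.
rewrite /root /sym_jac hornerD hornerN hornerM hornerZ hornerXsubC /= mulr1.
have -> : 2 * (jac d 1 n).[l] = (l - d n.+1) * (jac d 1 n.+1).[l]; last by rewrite subrr.
by apply: (mulIf x0); rewrite -[RHS]mulrA -row -x0N; ring.
Qed.

(** Strict convexity of the unit disc. *)
Lemma convex_unit_eq (K : numClosedFieldType) (I : finType) (w z : I -> K) :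
  (forall k, 0 < w k) -> \sum_k w k = 1 -> (forall k, `|z k| = 1) ->
  `|\sum_k w k * z k| = 1 -> forall k, z k = \sum_k w k * z k.
Proof.
move=> w0 w1 z1; set S := \sum_k _ => S1 k.
have cc (u : K) : `|u| = 1 -> u * u^* = 1 by move=> u1; rewrite -normCK u1 expr1n.
(* The variance of the z k under the weights w k is 1 - |S|^2. *)
have : \sum_k w k * `|z k - S| ^+ 2 = 0.
  transitivity (\sum_k (w k * 2 - w k * z k * S^* - (w k * z k)^* * S)).
    apply: eq_bigr => i _; rewrite normCK rmorphB [(w i * z i)^*]rmorphM /= (conj_Creal (gtr0_real (w0 i))).
    transitivity (w i * (z i * (z i)^* + S * S^* - z i * S^* - (z i)^* * S)); first by ring.
    by rewrite !cc //; ring.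
  rewrite !sumrB -!mulr_suml -rmorph_sum /= -/S w1 cc // mulrC [S^* * S]mulrC cc //; ring.
move/eqP; rewrite psumr_eq0 => [/allP/(_ k (mem_index_enum k))/=|i _]; last first.
  by rewrite mulr_ge0 ?exprn_ge0 // ltW.
by rewrite mulf_eq0 gt_eqF //= sqrf_eq0 normr_eq0 subr_eq0 => /eqP.
Qed.

(** * Unitary diagonalization of Hermitian matrices *)

Lemma mulmx_unitary_sum (K : numClosedFieldType) N (P : 'M[K]_N) : P \is unitarymx ->
  [/\ forall k k', \sum_j P k j * (P k' j)^* = (k == k')%:R,
      forall i, \sum_k `|P k i| ^+ 2 = 1 &
      forall (e : 'rV[K]_N) i j, (invmx P *m diag_mx e *m P) i j =
        \sum_k (P k i)^* * P k j * e 0 k].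
Proof.
move=> uP; split.
- move=> k k'; have /unitarymxP/matrixP/(_ k k') := uP; rewrite !mxE => <-.
  by apply: eq_bigr => j _; rewrite !mxE.
- move=> i; have := mulVmx (unitarymx_unit uP); rewrite invmx_unitary //.
  move/matrixP/(_ i i); rewrite !mxE eqxx mulr1n => <-.
  by apply: eq_bigr => j _; rewrite !mxE normCK mulrC.
- move=> e i j; rewrite invmx_unitary // !mxE; apply: eq_bigr => k _.
  by rewrite mul_mx_diag !mxE mulrAC.
Qed.

Lemma hermitian_eigenbasis (K : numClosedFieldType) N (A : 'M[K]_N) : A \is hermsymmx ->
  exists P : 'M[K]_N, exists2 z : 'rV[K]_N,
    P \is unitarymx /\ (forall k, z 0 k \is Num.real) &
    A = invmx P *m diag_mx z *m P.
Proof.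
move=> hA; exists (spectralmx A), (spectral_diag A); last first.
  by apply/orthomx_spectralP/hermitian_normalmx.
split=> [|k]; first exact: spectral_unitarymx.
by have /mxOverP := hermitian_spectral_diag_real hA.
Qed.

Lemma eigenbasis_row (K : fieldType) N (P A : 'M[K]_N) (z : 'rV[K]_N) : P \in unitmx ->
  A = invmx P *m diag_mx z *m P ->
  forall k j, \sum_i P k i * A i j = z 0 k * P k j.
Proof.
move=> uP AE k j; have : (P *m A) k j = (diag_mx z *m P) k j by rewrite AE !mulmxA mulmxV // mul1mx.
by rewrite mul_diag_mx !mxE.
Qed.

(** * The evolution operator *)

Section Exp.
Local Open Scope classical_set_scope.

Lemma lim_lincomb_mx (K : numFieldType) m (s : 'I_m.+1 -> nat -> K) (l : 'I_m.+1 -> K)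
    (A : 'I_m.+1 -> 'M[K]_m.+1) :
  (forall k, s k @ \oo --> l k) ->
  limn (fun n => \sum_k s k n *: A k) = \sum_k l k *: A k.
Proof.
move=> sl; apply: cvg_lim; first exact: norm_hausdorff.
apply: cvg_big => [|k _]; first exact: add_continuous.
exact: cvgZr_tmp.
Qed.

Lemma exp_conj_diag (K : fieldType) m (P : 'M[K]_m.+1) (z : 'rV[K]_m.+1) k : P \in unitmx ->
  (invmx P *m diag_mx z *m P) ^+ k = invmx P *m diag_mx (\row_j z 0 j ^+ k) *m P.
Proof.
move=> uP; elim: k => [|k IH].
  rewrite (_ : diag_mx _ = 1%:M) ?mulmx1 ?mulVmx //.
  by apply/matrixP => i j; rewrite !mxE expr0.
rewrite exprS IH -mulmxE -!mulmxA; congr (_ *m _).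
rewrite (mulmxA P) mulmxV // mul1mx mulmxA mulmx_diag.
by congr (diag_mx _ *m _); apply/rowP => j; rewrite !mxE exprS.
Qed.

Lemma conj_diagE (K : fieldType) m (P : 'M[K]_m) (w : 'rV[K]_m) :
  invmx P *m diag_mx w *m P = \sum_k w 0 k *: (invmx P *m delta_mx k k *m P).
Proof.
rewrite diag_mx_sum_delta mulmx_sumr mulmx_suml.
by apply: eq_bigr => k _; rewrite -scalemxAr -scalemxAl.
Qed.

(** Each partial sum is a combination of fixed matrices, one per eigenvalue, so convergence reduces
    to the scalar exponential series. *)
Lemma lim_exp_series_mx (K : numFieldType) m (P : 'M[K]_m.+1) (z E : 'rV[K]_m.+1) : P \in unitmx ->
  (forall k, series (fun j => (j`!%:R)^-1 * z 0 k ^+ j) @ \oo --> E 0 k) ->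
  limn (series (fun j : nat => (j`!%:R)^-1 *: (invmx P *m diag_mx z *m P) ^+ j)) =
  invmx P *m diag_mx E *m P.
Proof.
move=> uP cE.
rewrite (_ : series _ = (fun n => \sum_k series (fun j => (j`!%:R)^-1 * z 0 k ^+ j) n *:
    (invmx P *m delta_mx k k *m P))); last first.
  apply/funext => n; rewrite /series /=.
  under eq_bigr do rewrite exp_conj_diag // conj_diagE scaler_sumr.
  rewrite exchange_big /=; apply: eq_bigr => k _.
  by rewrite scaler_suml; apply: eq_bigr => j _; rewrite scalerA mxE.
by rewrite conj_diagE; apply: lim_lincomb_mx.
Qed.

Variable R : realType.
Local Notation C := ((R[i] : numClosedFieldType) : numFieldType).

Lemma norm_real_complex (x : R) : `|x%:C| = `|x|%:C.
Proof. by rewrite normc_def /= expr0n addr0 sqrtr_sqr. Qed.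

Lemma cvg_real_complex (u : nat -> R) (l : R) :
  u @ \oo --> l -> ((u n)%:C : C) @[n --> \oo] --> (l%:C : C).
Proof.
move=> ul; apply/cvgrPdist_lt => -[e e']; rewrite ltcE /= => /andP[/eqP -> e0].
have /cvgrPdist_lt /(_ _ e0) := ul.
by apply: filterS => n; rewrite -rmorphB norm_real_complex ltcR.
Qed.

(** Shaped after [cos_coeff] and [sin_coeff], so that the exponential series splits term by term. *)
Lemma imaginary_exp n : 'i%R ^+ n =
  (~~ odd n)%:R * (-1) ^+ n./2 + 'i%R * ((odd n)%:R * (-1) ^+ n.-1./2) :> C.
Proof.
rewrite -[in LHS](odd_double_half n) -mul2n exprD exprM sqrCi.
case: n => [|n] /=; first by rewrite !expr0; ring.
by rewrite uphalf_half; case: (odd n); rewrite /= ?add1n ?add0n ?exprS ?expr0; ring.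
Qed.

Definition cis (x : R) : C := (cos x)%:C + 'i%R * (sin x)%:C.

Lemma cvg_exp_series_cis (x : R) :
  series (fun k => (k`!%:R)^-1 * ('i%R * x%:C) ^+ k : C) @ \oo --> cis x.
Proof.
rewrite [X in X @ _](_ : _ = (fun n => (series (cos_coeff x) n)%:C + 'i%R * (series (sin_coeff x) n)%:C)); last first.
  apply/funext => n; rewrite /series /= !rmorph_sum mulr_sumr -big_split /=.
  apply: eq_bigr => k _; rewrite exprMn imaginary_exp /cos_coeff /sin_coeff /=.
  rewrite !rmorphM /= !fmorphV /= !rmorphXn /= !rmorphN1 !rmorph_nat; ring.
apply: cvgD.
  by apply: cvg_real_complex; rewrite cos.unlock; exact: is_cvg_series_cos_coeff.
apply: cvgMl_tmp.
by apply: cvg_real_complex; rewrite sin.unlock; exact: is_cvg_series_sin_coeff.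
Qed.

Lemma expmx_conj_diag m (P : 'M[R[i]]_m.+1) (z E : 'rV[R[i]]_m.+1) : P \in unitmx ->
  (forall k, series (fun j => (j`!%:R)^-1 * z 0 k ^+ j : C) @ \oo --> (E 0 k : C)) ->
  expmx (invmx P *m diag_mx z *m P) = invmx P *m diag_mx E *m P.
Proof. exact: (@lim_exp_series_mx C). Qed.

End Exp.

(** * Trigonometry of unit complex numbers *)

Section Trig.
Variable R : realType.

Lemma cos_period (x : R) (k : int) : cos (x + pi *+ 2 *~ k) = cos x.
Proof.
have per n (y : R) : cos (y + pi *+ 2 *+ n) = cos y by apply: periodicn; apply: cosD2pi.
case: k => n; first by rewrite per.
by rewrite NegzE mulrNz -[in RHS](subrK (pi *+ 2 *~ n.+1) x) per.
Qed.

(** Reduce modulo 2 pi to [y] in [0, 2 pi); injectivity of cosine on [0, pi] applies to [y] or to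
    its reflection 2 pi - y. *)
Lemma cos_eq1 (x : R) : cos x = 1 -> exists k : int, x = pi * (2 * k)%:~R.
Proof.
move=> cx; pose k := Num.floor (x / (pi *+ 2)).
have pi0 : 0 < pi *+ 2 :> R by rewrite pmulrn_lgt0 // pi_gt0.
pose y := x - pi *+ 2 *~ k.
have cy : cos y = 1 by rewrite /y -mulrNz cos_period.
have y0 : 0 <= y.
  by rewrite /y subr_ge0 -mulrzr mulrC -ler_pdivlMr // floor_le_tmp.
have y2 : y < pi *+ 2.
  rewrite /y ltrBlDr -mulrzr -{1}[pi *+ 2]mulr1 -mulrDr mulrC -ltr_pdivrMr // addrC.
  by have := floorD1_gt (x / (pi *+ 2)); rewrite intrD.
exists k; apply/eqP; rewrite -subr_eq0; apply/eqP.
transitivity y; first by rewrite /y intrM -mulrzr mulr2n; ring.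
have [yp|yp] := leP y pi.
  by apply: cos_inj; rewrite ?in_itv /= ?y0 ?lexx ?pi_ge0 // cy cos0.
have : pi *+ 2 - y = 0.
  apply: cos_inj; rewrite ?in_itv /= ?lexx ?pi_ge0 //.
    by rewrite subr_ge0 ltW //= lerBlDr mulr2n lerD2l ltW.
  by rewrite addrC -(mulr1z (pi *+ 2)) cos_period cosN cy cos0.
by move=> e; move: y2; rewrite -subr_gt0 e ltxx.
Qed.

Lemma cos_eq_sign (x : R) (s : bool) : cos x = (-1) ^+ s ->
  exists k : int, x = pi * (2 * k + s)%:~R.
Proof.
case: s => cx; last by have [k ->] := cos_eq1 cx; exists k; rewrite addr0.
have [|k kE] := @cos_eq1 (x - pi).
  by apply: oppr_inj; rewrite -cosDpi subrK cx.
by exists k; rewrite -(subrK pi x) kE intrD mulrDr mulr1.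
Qed.

Lemma conj_real_complex (x : R) : (x%:C)^* = x%:C :> R[i].
Proof. by apply: conj_Creal; apply/complex_realP; exists x. Qed.

Lemma conj_cis (x : R) : (cis x)^* = (cos x)%:C - 'i%R * (sin x)%:C.
Proof. by rewrite /cis rmorphD rmorphM /= !conj_real_complex conjCi mulNr. Qed.

Lemma cis_conjM (a b : R) : cis a * (cis b)^* = cis (a - b).
Proof.
rewrite conj_cis /cis cosB sinB rmorphD rmorphB !rmorphM /=.
have := sqrCi R[i]; rewrite expr2 => i2.
transitivity ((cos a)%:C * (cos b)%:C - ('i%R * 'i%R) * ((sin a)%:C * (sin b)%:C)
   + 'i%R * ((sin a)%:C * (cos b)%:C - (cos a)%:C * (sin b)%:C)); first by ring.
by rewrite i2 mulN1r opprK.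
Qed.

Lemma norm_cis (a : R) : `|cis a| = 1.
Proof.
apply/eqP; rewrite -(@eqrXn2 _ 2) ?ler01 // normCK cis_conjM subrr /cis cos0 sin0.
by rewrite mulr0 addr0 expr1n.
Qed.

Lemma cis_eq_sign (a b : R) (s : bool) : (-1) ^+ s * cis a = cis b -> cos (a - b) = (-1) ^+ s.
Proof.
move=> e; have : cis (a - b) = (-1) ^+ s.
  by rewrite -cis_conjM -e rmorphM rmorph_sign mulrCA cis_conjM subrr /cis cos0 sin0 mulr0 addr0 mulr1.
move/(congr1 (fun z => 'Re z)); rewrite Re_rect; try by apply/complex_realP; eexists.
rewrite (Creal_ReP _ _) ?rpred_sign // => e'.
by apply: (@complexI R); rewrite e' rmorph_sign.
Qed.

End Trig.

(** * Perfect state transfer *)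

Lemma monic_prod_roots (K : fieldType) (I : finType) (A : {pred I}) (y : I -> K) (p : {poly K}) :
  p \is monic -> size p = #|A|.+1 -> {in A &, injective y} -> {in A, forall k, root p (y k)} ->
  p = \prod_(z <- [seq y k | k in A]) ('X - z%:P).
Proof.
move=> /monicP mp sp inj rt.
rewrite {1}(@all_roots_prod_XsubC _ p [seq y k | k in A]) ?mp ?scale1r //.
- by rewrite size_image.
- by apply/allP => z /mapP[k]; rewrite mem_enum => kA ->; apply: rt.
- by rewrite uniq_rootsE; apply/dinjectiveP.
Qed.

(** Here [s] marks the antisymmetric eigenvectors. The phase condition puts the two spectra on the
    even and odd points of one lattice. *)
Lemma alternating_phases_absurd (R : realType) (m : nat) (d : nat -> R) (T : R)
    (I : finType) (l : I -> R) (s : pred I) :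
  #|I| = m.+2.*2.+1 -> injective l ->
  (forall k, root (if s k then jac d 1 m.+2 else sym_jac d 1 m.+2) (l k)) ->
  (forall k k', cos (T * l k - T * l k') = (-1) ^+ (s k (+) s k')) ->
  False.
Proof.
move=> cI linj rt cosE.
have bound (p : {poly R}) (A : {pred I}) : p != 0 -> {in A, forall k, root p (l k)} ->
    (#|A| < size p)%N.
  move=> p0 rA; rewrite -(size_image l); apply: max_poly_roots => //.
    by apply/allP => z /mapP[k]; rewrite mem_enum => kA ->; apply: rA.
  by apply/dinjectiveP => k k' _ _; apply: linj.
have [ms ss] := sym_jac_monic_size d 1 m.+1.
(* Degrees bound the two classes by m + 2 and m + 3, which add up to the size of [I]; hence both
   bounds are attained. *)
have cs : (#|s| < m.+3)%N.
  rewrite -(size_jac d 1 m.+2); apply: bound; first by rewrite monic_neq0 ?jac_monic.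
  by move=> k ks; have := rt k; rewrite (ks : s k).
have cns : (#|[predC s]| < m.+4)%N.
  rewrite -ss; apply: bound; first by rewrite monic_neq0.
  by move=> k ks; have := rt k; rewrite (negbTE (ks : ~~ s k)).
have cC := cardC s.
have {cs cns cC} [cs cns] : #|s| = m.+2 /\ #|[predC s]| = m.+3 by lia.
have /card_gt0P[k0 k0s] : (0 < #|[predC s]|)%N by rewrite cns.
have /card_gt0P[k1 k1s] : (0 < #|s|)%N by rewrite cs.
have {}k0s : ~~ s k0 := k0s; have {}k1s : s k1 := k1s.
(* At time 0 every cosine is 1, but [k1] and [k0] lie in opposite classes and require -1. *)
have T0 : T != 0.
  apply/eqP => T0; have := cosE k1 k0; rewrite T0 !mul0r subrr cos0 k1s (negbTE k0s) /= expr1.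
  by move=> h; have := @ltr01 R; lra.
have pi0 : pi != 0 :> R by rewrite gt_eqF ?pi_gt0.
(* The spacing of the lattice. The symmetric index [k0] serves as origin, so that symmetric
   eigenvalues become even integers. *)
pose al := pi / T.
have al0 : al != 0 by rewrite mulf_neq0 ?invr_eq0.
have /choice[a aE] : forall k, exists z : int, l k = al * (2 * z + s k)%:~R + l k0.
  move=> k; have := cosE k k0; rewrite (negbTE k0s) addbF => /cos_eq_sign[z zE].
  exists z; apply: (mulfI T0); rewrite mulrDr -[LHS](subrK (T * l k0)) zE /al; congr (_ + _).
  by field.
pose dl j := (d j - l k0) / al; pose be := al ^- 2.
have dE : d =1 (fun j => al * dl j + l k0).
  by move=> j; rewrite /dl mulrCA divff // mulr1 subrK.
have bE : al ^+ 2 * be = 1 by rewrite divff // expf_neq0.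
pose y k : R := (2 * a k + s k)%:~R.
have yinj : injective y by move=> k k' e; apply: linj; rewrite (aE k) (aE k') -/(y k) e.
have rts : {in s, forall k, root (jac dl be m.+2) (y k)}.
  move=> k ks; have := rt k; rewrite (ks : s k) (aE k) -/(y k) -bE.
  rewrite (eq_jac _ (fun j _ => dE j)) /root horner_jac_affine mulf_eq0 expf_eq0 /=.
  by rewrite (negbTE al0).
have rtns : {in [predC s], forall k, root (sym_jac dl be m.+2) (y k)}.
  move=> k ks; have := rt k; rewrite (negbTE (ks : ~~ s k)) (aE k) -/(y k) -bE.
  rewrite (eq_sym_jac _ _ dE) /root horner_sym_jac_affine mulf_eq0 expf_eq0 /=.
  by rewrite (negbTE al0).
apply: (@parity_spectrum_absurd R m dl be [seq a k | k in [predC s]] [seq a k | k in s]).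
- by rewrite invr_eq0 expf_neq0.
- by rewrite size_image.
- by rewrite size_image.
- rewrite (monic_prod_roots (jac_monic _ _ _) _ (in2W yinj) rts) ?size_jac ?cs //.
  rewrite !big_image /=; apply: eq_bigr => k ks; by rewrite /y (ks : s k).
- have [ms' ss'] := sym_jac_monic_size dl be m.+1.
  rewrite (monic_prod_roots ms' _ (in2W yinj) rtns) ?ss' ?cns //.
  by rewrite !big_image /=; apply: eq_bigr => k ks; rewrite /y (negbTE (ks : ~~ s k)) addr0.
Qed.

Lemma scale_conj_diag (K : fieldType) m (P : 'M[K]_m) (z : 'rV[K]_m) a :
  a *: (invmx P *m diag_mx z *m P) = invmx P *m diag_mx (a *: z) *m P.
Proof. by rewrite linearZ /= -scalemxAr -scalemxAl. Qed.

Lemma expmx_unitary_diag (R : realType) m (P : 'M[R[i]]_m.+1) (l : 'I_m.+1 -> R) (t : R) i j :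
  P \is unitarymx ->
  expmx (('i * t%:C)%R *: (invmx P *m diag_mx (\row_k (l k)%:C) *m P)) i j =
  \sum_k (P k i)^* * P k j * cis (t * l k).
Proof.
move=> uP; rewrite scale_conj_diag (@expmx_conj_diag _ _ _ _ (\row_k cis (t * l k))).
- have [_ _ ->] := mulmx_unitary_sum uP.
  by apply: eq_bigr => k _; rewrite mxE.
- exact: unitarymx_unit.
- move=> k; rewrite !mxE -mulrA -rmorphM; exact: cvg_exp_series_cis.
Qed.

Lemma hermitian_real_eigenbasis (R : realType) N (A : 'M[R[i]]_N) : A \is hermsymmx ->
  exists P : 'M[R[i]]_N, exists2 l : 'I_N -> R, P \is unitarymx &
    A = invmx P *m diag_mx (\row_k (l k)%:C) *m P.
Proof.
move=> /hermitian_eigenbasis[P [z [uP zR] AE]].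
have zE : \row_k (complex.Re (z 0 k))%:C = z by apply/rowP => k; rewrite mxE RRe_real.
by exists P, (fun k => complex.Re (z 0 k)); rewrite ?zE.
Qed.

Lemma hamiltonian_hermitian (R : realType) n (q : nat -> R) :
  map_mx (fun x : R => x%:C) (hamiltonian n q) \is hermsymmx.
Proof.
apply/is_hermitianmxP; rewrite expr0 scale1r; apply/matrixP => i j.
rewrite !mxE conj_real_complex orbC; congr (_ - _)%:C.
by rewrite eq_sym; case: eqP => // ->.
Qed.

Definition path_diag (R : realType) n (q : nat -> R) j : R := - q (minn j (n.*2 - j)).

(** Columns are summed because the rows of the diagonalizing matrix are left eigenvectors. *)
Lemma hamiltonian_col (R : realType) n (q : nat -> R) (x : nat -> R[i]) (j : 'I_n.*2.+1) :
  \sum_(i < n.*2.+1) x i * map_mx (fun x : R => x%:C) (hamiltonian n q) i j =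
  path_nbr_sum n.*2 x j + (path_diag n q j)%:C * x j.
Proof.
rewrite -sum_path_adj (bigD1 j) //= [in RHS](bigD1 j) //= [RHS]addrAC; congr (_ + _).
  rewrite !mxE eqxx mulr1n rmorphB rmorphN /= mulrBr mulNr; congr (_ - _); last by rewrite mulrC.
  by congr (_ * _); case: ifP.
apply: eq_bigr => i ij; rewrite !mxE (negbTE ij) mulr0n subr0.
by congr (_ * _); case: ifP.
Qed.

(* Path on 2n+1 >= 5 vertices (n >= 2), endpoints u = 0 and v = 2n. *)
Theorem theorem5 (R : realType) (n : nat) (hn : (2 <= n)%N) (q : nat -> R) :
  forall T : R, ~ @pst R n q ord0 ord_max T.
Proof.
case: n hn => [|[|m]] // _ T; rewrite /pst /U_t; set n := m.+2; set N := n.*2.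
have [P [l uP AE]] := hermitian_real_eigenbasis (hamiltonian_hermitian n q).
rewrite {1}AE expmx_unitary_diag // => S1.
pose x k j : R[i] := P k (inord j).
have xP k (j : 'I_N.+1) : x k j = P k j by rewrite /x inord_val.
pose d := path_diag n q.
have dsym j : (j <= N)%N -> (d (N - j)%N)%:C = (d j)%:C :> R[i].
  by move=> jN; rewrite /d /path_diag subKn // minnC.
have row k j : (j <= N)%N ->
    path_nbr_sum N (x k) j + (d j)%:C * x k j = (l k)%:C * x k j.
  move=> jN; have := eigenbasis_row (unitarymx_unit uP) AE k (Ordinal (jN : (j < N.+1)%N)).
  rewrite [X in _ = X * _]mxE -xP => <-; rewrite -[j in LHS]/(nat_of_ord (Ordinal (jN : (j < N.+1)%N))).
  by rewrite -hamiltonian_col; apply: eq_bigr => i _; rewrite xP.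
have [orth colnorm _] := mulmx_unitary_sum uP.
have xE k j : (j <= N)%N -> x k j = ((jac d 1 j).[l k])%:C * x k 0%N.
  move=> jN; rewrite (@jac_eigenvector _ N (fun j => (d j)%:C) (x k) (l k)%:C) //.
    by rewrite -horner_map map_jac rmorph1.
  by move=> i /ltnW; apply: row.
(* Inner products of eigenvectors, written through their first entries. Orthonormality then makes
   every first entry nonzero, and makes the spectrum simple: for equal eigenvalues the sum of
   squares starts with 1 and is positive. *)
have dot k k' : (k == k')%:R = x k 0%N * (x k' 0%N)^* * \sum_(j < N.+1)
     ((jac d 1 j).[l k] * (jac d 1 j).[l k'])%:C.
  rewrite -orth mulr_sumr; apply: eq_bigr => j _.
  have jN : (j <= N)%N by rewrite -ltnS.
  rewrite -(xP k j) -(xP k' j) (xE k j jN) (xE k' j jN) [(_ * x k' 0%N)^*]rmorphM /=.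
  rewrite conj_real_complex (rmorphM (real_complex R)) /=; ring.
have x0 k : x k 0%N != 0.
  by apply: contraPneq (dot k k) => ->; rewrite eqxx !mul0r => /eqP; rewrite oner_eq0.
have linj : injective l.
  move=> k k' lkk; apply/eqP; apply: contraPT (dot k k') => /negbTE ->.
  move/esym/eqP; rewrite lkk !mulf_eq0 conjC_eq0 !(negbTE (x0 _)) /= -rmorph_sum.
  rewrite fmorph_eq0 big_ord_recl jac0 hornerC mulr1 gt_eqF // ltr_wpDr //.
  by apply: sumr_ge0 => j _; rewrite -expr2 sqr_ge0.
pose s k := x k N != x k 0%N.
have sP k : x k N = (-1) ^+ s k * x k 0%N /\
    root (if s k then jac d 1 n else sym_jac d 1 n) (l k).
  have := mirror_eigenvector (isT : (0 < n)%N) (x0 k) dsym (@row k).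
  have rC (p : {poly R}) : root (map_poly (real_complex R) p) (l k)%:C = root p (l k).
    exact: fmorph_root.
  rewrite -[fun j => (d j)%:C]/(real_complex R \o d) -(rmorph1 (real_complex R)).
  rewrite -map_jac -map_sym_jac !rC /s => -[[-> r]|[-> r]].
    by rewrite eqxx expr0 mul1r.
  suff -> : - x k 0%N != x k 0%N by rewrite expr1 mulN1r.
  by rewrite eqNr.
apply: (@alternating_phases_absurd R m d T _ l s) => //.
- by rewrite card_ord.
- by move=> k; have [] := sP k.
(* The transfer amplitude is a convex combination: the weights are the squared moduli of column 0 of
   [P], and the mirror sign is absorbed into the phase. *)
have zS := @convex_unit_eq _ _ (fun k => `|x k 0%N| ^+ 2) (fun k => (-1) ^+ s k * cis (T * l k)).
move=> k k'; have zkk : (-1) ^+ s k * cis (T * l k) = (-1) ^+ s k' * cis (T * l k') :> R[i].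
  have w0 i : 0 < `|x i 0%N| ^+ 2 by rewrite exprn_gt0 // normr_gt0.
  have w1 : \sum_i `|x i 0%N| ^+ 2 = 1.
    by rewrite -(colnorm ord0); apply: eq_bigr => i _; rewrite -xP.
  have z1 i : `|(-1) ^+ s i * cis (T * l i)| = 1 :> R[i] by rewrite normrM normr_sign mul1r norm_cis.
  suff S1' : `|\sum_i `|x i 0%N| ^+ 2 * ((-1) ^+ s i * cis (T * l i))| = 1.
    by rewrite (zS w0 w1 z1 S1' k) (zS w0 w1 z1 S1' k').
  rewrite -[RHS]S1; congr `|_|.
  apply: eq_bigr => i _; rewrite -(xP i ord0) -(xP i ord_max); have [/= -> _] := sP i.
  by rewrite normCK [_ * _^*]mulrC -!mulrA; congr (_ * _); rewrite mulrCA.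
apply: cis_eq_sign.
by rewrite signr_addb mulrAC zkk mulrAC -signr_addb addbb expr0 mul1r.
Qed.
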